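(* Let $n\ge 1$ and let $f:\{0,1\}^n\to\{0,1\}$ be a balanced function that is non-entangling for the Deutsch-Jozsa algorithm. Then there exist $c\in\{0,1\}$ and $a\in\{0,1\}^n$ such that $f(x)=(a\cdot x)\oplus c$ for all $x\in\{0,1\}^n$.
   Context: For $a,x\in\{0,1\}^n$, $a\cdot x=\sum_i a_ix_i \bmod 2$, and $\oplus$ is addition modulo 2. A function $f:\{0,1\}^n\to\{0,1\}$ is balanced if it takes the value 1 on exactly half of the $2^n$ inputs (and 0 on the other half). A pure state of $m$ qubits (unit vector in $(\mathbb{C}^2)^{\otimes m}$) is separable if it is a tensor product of $m$ single-qubit states. The quantum oracle of $f$ is the unitary $U_f$ on $n+1$ qubits with $U_f|x\rangle|y\rangle=|x\rangle|y\oplus f(x)\rangle$. In the Deutsch-Jozsa algorithm the oracle is applied to $|\psi_1\rangle=\frac{1}{\sqrt{2^n}}\sum_{x\in\{0,1\}^n}|x\rangle\otimes\frac{|0\rangle-|1\rangle}{\sqrt2}$, giving $|\psi_2\rangle=\frac{1}{\sqrt{2^n}}\sum_{x\in\{0,1\}^n}(-1)^{f(x)}|x\rangle\otimes\frac{|0\rangle-|1\rangle}{\sqrt2}$. The function $f$ is called non-entangling for the Deutsch-Jozsa algorithm if $|\psi_2\rangle$ is separable (as a state of $n+1$ qubits). *)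

(* Defs.v *)
From mathcomp Require Import all_boot all_order all_algebra.
From mathcomp Require Import reals complex.

Set Implicit Arguments.
Unset Strict Implicit.
Unset Printing Implicit Defensive.

Import Order.TTheory GRing.Theory Num.Theory.
Local Open Scope ring_scope.

Definition bits (m : nat) := {ffun 'I_m -> bool}.

Definition dotb (n : nat) (a x : bits n) : bool :=
  odd (\sum_(i < n) a i * x i)%N.

Definition balanced (n : nat) (f : bits n -> bool) : Prop :=
  (2 * #|[set x | f x]| = 2 ^ n)%N.

(* A vector of (C^2)^{(x) m} is given by its amplitudes in the computational
   basis; R[i] is the field of complex numbers over the reals R. *)
Definition qvec (R : realType) (m : nat) := {ffun bits m -> R[i]}.

Definition is_state (R : realType) (m : nat) (psi : qvec R m) : Prop :=
  \sum_(x : bits m) `|psi x| ^+ 2 = 1.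

Definition ket (R : realType) (m : nat) (x : bits m) : qvec R m :=
  [ffun z => (z == x)%:R].

Definition bit1 (b : bool) : bits 1 := [ffun=> b].

Definition lbits (m k : nat) (z : bits (m + k)) : bits m :=
  [ffun i => z (lshift k i)].
Definition rbits (m k : nat) (z : bits (m + k)) : bits k :=
  [ffun i => z (rshift m i)].
Definition catb (m k : nat) (x : bits m) (y : bits k) : bits (m + k) :=
  [ffun i => match split i with inl j => x j | inr j => y j end].

Definition tensor (R : realType) (m k : nat)
    (phi : qvec R m) (chi : qvec R k) : qvec R (m + k) :=
  [ffun z => phi (lbits z) * chi (rbits z)].

Definition bigtensor (R : realType) (m : nat) (q : 'I_m -> qvec R 1) :
    qvec R m :=
  [ffun z : bits m => \prod_(i < m) q i (bit1 (z i))].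

Definition separable (R : realType) (m : nat) (psi : qvec R m) : Prop :=
  exists q : 'I_m -> qvec R 1,
    (forall i, is_state (q i)) /\ psi = bigtensor q.

(* The linear extension of |x>|y> |-> |x>|y (+) f x>; see [oracle_ket]. *)
Definition oracle (R : realType) (n : nat) (f : bits n -> bool)
    (psi : qvec R (n + 1)) : qvec R (n + 1) :=
  \sum_(x : bits n) \sum_(y : bool)
    psi (catb x (bit1 y)) *: tensor (ket R x) (ket R (bit1 (y (+) f x))).

Definition ket_minus (R : realType) : qvec R 1 :=
  (sqrtC 2)^-1 *: (ket R (bit1 false) - ket R (bit1 true)).

Definition psi1 (R : realType) (n : nat) : qvec R (n + 1) :=
  (sqrtC (2 ^+ n))^-1 *: \sum_(x : bits n) tensor (ket R x) (ket_minus R).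

Definition psi2 (R : realType) (n : nat) (f : bits n -> bool) :
    qvec R (n + 1) :=
  oracle f (psi1 R n).

Definition non_entangling (R : realType) (n : nat) (f : bits n -> bool) :
    Prop :=
  separable (psi2 R f).

Lemma catb_l (m k : nat) (x : bits m) (y : bits k) : lbits (catb x y) = x.
Proof. by apply/ffunP=> i; rewrite !ffunE (unsplitK (inl i)). Qed.

Lemma catb_r (m k : nat) (x : bits m) (y : bits k) : rbits (catb x y) = y.
Proof. by apply/ffunP=> i; rewrite !ffunE (unsplitK (inr i)). Qed.

Lemma bit1_inj : injective bit1.
Proof. by move=> b c /ffunP /(_ ord0); rewrite !ffunE. Qed.

Lemma oracle_linear (R : realType) (n : nat) (f : bits n -> bool)
    (a : R[i]) (u v : qvec R (n + 1)) :
  oracle f (a *: u + v) = a *: oracle f u + oracle f v.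
Proof.
rewrite /oracle scaler_sumr -big_split; apply: eq_bigr => x _ /=.
rewrite scaler_sumr -big_split; apply: eq_bigr => y _ /=.
by rewrite !ffunE scalerDl scalerA.
Qed.

Lemma oracle_ket (R : realType) (n : nat) (f : bits n -> bool)
    (x : bits n) (y : bool) :
  oracle f (tensor (ket R x) (ket R (bit1 y)))
  = tensor (ket R x) (ket R (bit1 (y (+) f x))).
Proof.
rewrite /oracle (bigD1 x) //= [X in _ + X]big1 => [|z zx]; last first.
  by rewrite big1 // => b _; rewrite !ffunE catb_l (negPf zx) mul0r scale0r.
rewrite addr0 (bigD1 y) //= [X in _ + X]big1 => [|b by_]; last first.
  by rewrite !ffunE catb_r (inj_eq bit1_inj) (negPf by_) mulr0 scale0r.
by rewrite addr0 !ffunE catb_l catb_r !eqxx mul1r scale1r.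
Qed.

Lemma psi2E (R : realType) (n : nat) (f : bits n -> bool) :
  psi2 R f = (sqrtC (2 ^+ n))^-1 *:
    \sum_(x : bits n) (-1) ^+ f x *: tensor (ket R x) (ket_minus R).
Proof.
have o0 : oracle f (0 : qvec R (n + 1)) = 0.
  by rewrite /oracle !big1 // => x _; rewrite big1 // => y _; rewrite ffunE scale0r.
have oD u v : oracle f (u + v : qvec R (n + 1)) = oracle f u + oracle f v.
  by have := oracle_linear f 1 u v; rewrite !scale1r.
have oZ a u : oracle f (a *: u : qvec R (n + 1)) = a *: oracle f u.
  by have := oracle_linear f a u 0; rewrite o0 !addr0.
rewrite /psi2 /psi1 oZ (big_morph _ oD o0); congr (_ *: _).
apply: eq_bigr => x _.
have -> : tensor (ket R x) (ket_minus R) = (sqrtC 2)^-1 *: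
    (tensor (ket R x) (ket R (bit1 false))
     + (-1) *: tensor (ket R x) (ket R (bit1 true))).
  by apply/ffunP=> z; rewrite !ffunE /GRing.scale /= mulN1r -mulrBr mulrCA.
rewrite oZ oD oZ !oracle_ket scalerA mulrC -scalerA; congr (_ *: _).
case: (f x); rewrite /= ?expr0 ?expr1 ?scale1r // scalerDr scalerA mulrNN.
by rewrite mulr1 scale1r addrC.
Qed.

(* Main.v *)
(* Up to a nonzero constant, the amplitude of psi2 at |x>|0> is (-1)^(f x).  If
   psi2 is a product state, this sign is a product over i of factors depending
   only on the bit x_i.  So flipping bit i always multiplies the sign by the
   same amount, which the flip from 0 to e_i identifies as
   (-1)^(f e_i (+) f 0); hence f x = a . x (+) f 0 with
   a_i = f e_i (+) f 0. *)
Require Import Defs.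
From mathcomp Require Import all_boot all_order all_algebra.
From mathcomp Require Import reals complex.

Set Implicit Arguments.
Unset Strict Implicit.
Unset Printing Implicit Defensive.

Import Order.TTheory GRing.Theory Num.Theory.
Local Open Scope ring_scope.

Definition zerob (n : nat) : bits n := [ffun=> false].
Definition unitb (n : nat) (i : 'I_n) : bits n := [ffun j => j == i].

Lemma sign_dotb (F : pzRingType) (n : nat) (a x : bits n) :
  (-1) ^+ dotb a x = \prod_(i < n) (-1) ^+ (a i * x i) :> F.
Proof.
rewrite /dotb signr_odd.
exact: (big_morph (fun m => (-1) ^+ m) (exprD (-1)) (expr0 (-1))).
Qed.

(** The algebraic core, free of quantum states: [k] will absorb the normalisation and the amplitude
    of the oracle's target qubit. *)
Lemma affine_of_product_sign (F : numFieldType) (n : nat) (f : bits n -> bool)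
    (k : F) (q : 'I_n -> bool -> F) :
    (forall x : bits n, k * \prod_(i < n) q i (x i) = (-1) ^+ f x) ->
  forall x : bits n, f x = dotb [ffun i => f (unitb i) (+) f (zerob n)] x (+) f (zerob n).
Proof.
move=> fE x; apply: (@signr_inj F).
(* The inputs 0 and e_i differ only at bit i, so their products share the factor [p] over the other
   bits. *)
have qE i : q i true = q i false * (-1) ^+ (f (unitb i) (+) f (zerob n)).
  have := fE (zerob n); have := fE (unitb i).
  rewrite (bigD1 i) //= [in X in _ -> X](bigD1 i) //= !ffunE eqxx.
  rewrite (eq_bigr (fun j => q j false)) => [|j /negPf ji]; last by rewrite ffunE ji.
  rewrite [in X in _ -> X](eq_bigr (fun j => q j false)) => [|j _]; last by rewrite ffunE.
  set p := \prod_(_ < _ | _) _ => e1 e0.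
  (* [k * p] divides a sign, so it is nonzero and can be cancelled. *)
  have kp0 : k * p != 0.
    apply/eqP => kp; move/eqP: e0.
    by rewrite mulrCA kp mulr0 eq_sym signr_eq0.
  apply: (mulfI kp0); rewrite -mulrA [p * _]mulrC e1 mulrA.
  by rewrite -(mulrA k) [p * _]mulrC e0 signr_addb mulrCA -expr2 sqrr_sign mulr1.
(* Turning the signs of [f x] and [f (zerob n)] back into products leaves one identity per bit:
   trivial if [x i] is false, [qE] otherwise. *)
rewrite signr_addb sign_dotb -!fE mulrCA -big_split /=; congr (_ * _).
apply: eq_bigr => i _; rewrite !ffunE.
by case: (x i); rewrite ?muln1 ?muln0 ?expr0 ?mul1r // qE mulrC.
Qed.

Lemma psi2_amplitude0 (R : realType) (n : nat) (f : bits n -> bool) (x : bits n) :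
  psi2 R f (catb x (bit1 false))
  = (sqrtC (2 ^+ n))^-1 * (sqrtC 2)^-1 * (-1) ^+ f x.
Proof.
(* Only the summand of [x] survives; target bit 0 selects the coefficient +1 in [ket_minus]. *)
rewrite psi2E ffunE sum_ffunE (bigD1 x) //= big1 => [|y yx].
  rewrite addr0 !ffunE catb_l catb_r !eqxx (inj_eq bit1_inj) /= subr0.
  by rewrite /GRing.scale /= mulr1 mul1r -mulrA [_ * (-1) ^+ _]mulrC.
by rewrite !ffunE catb_l eq_sym (negPf yx) mul0r scaler0.
Qed.

Theorem proposition2p4 (R : realType) (n : nat) (n_ge1 : (1 <= n)%N)
    (f : bits n -> bool) (f_balanced : balanced f)
    (f_non_entangling : non_entangling R f) :
  exists (c : bool) (a : bits n), forall x : bits n, f x = dotb a x (+) c.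
Proof.
case: f_non_entangling => q [_ psiE].
set K : R[i] := (sqrtC (2 ^+ n))^-1 * (sqrtC 2)^-1.
have K0 : K != 0.
  by rewrite mulf_neq0 // invr_eq0 sqrtC_eq0 ?expf_neq0 // pnatr_eq0.
exists (f (zerob n)), [ffun i => f (unitb i) (+) f (zerob n)].
(* The target qubit is frozen at 0; its amplitude divided by [K] serves as the constant [k]. *)
apply: (@affine_of_product_sign _ _ _ (K^-1 * q (rshift n ord0) (bit1 false))
          (fun i b => q (lshift 1 i) (bit1 b))) => x.
apply: (mulfI K0); rewrite -psi2_amplitude0 psiE ffunE big_split_ord big_ord1 /=.
rewrite -(mulrA K^-1) mulVKf // mulrC; congr (_ * _).
  by apply: eq_bigr => i _; rewrite ffunE (unsplitK (inl i)).
by rewrite ffunE (unsplitK (inr ord0)) ffunE.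
Qed.
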